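(* Let $u'=\phi(x,u)$ be a first-order ODE whose associated curvature $\mathcal{K}(x,u)=-(\phi_{xu}+\phi_u^2+\phi\,\phi_{uu})(x,u)$ satisfies $\mathcal{K}(x,u)=\kappa(x)$. Let $V$ be the solution space of $y''+\kappa(x)y=0$ with fixed basis $\{y_1,y_2\}$, let $c(x)=\phi_x+\phi\,\phi_u+\kappa(x)u$ (a function of $x$ alone), and let $u_p$ be a fixed particular solution of $u''+\kappa(x)u=c(x)$. Let $f(x;s)$, $s\in J$, with $J$ an open interval, be a smooth one-parameter family of solutions of $u'=\phi(x,u)$, written as $$f(x;s)=u_p(x)+c_1(s)\,y_1(x)+c_2(s)\,y_2(x)$$ with smooth scalar functions $c_1,c_2\colon J\to\mathbb{R}$. Then, for each $s\in J$, the function $p_s(x):=\phi_u(x,f(x;s))$, which is a solution of the Riccati equation $p'+p^2+\kappa(x)=0$, has homogeneous coordinates $[c_1'(s):c_2'(s)]$ in $\mathbb{P}(V)$. That is, $p_s$ corresponds to the tangent direction of $\Gamma$ at the point $f(\cdot\,;s)$.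
   Context: Under the curvature hypothesis every solution of the first-order ODE lies in the two-dimensional affine space $S=u_p+V$ of solutions of $u''+\kappa(x)u=c(x)$, so each $f(\cdot\,;s)$ has the displayed form. $\Gamma\subset S$ is the solution set of the first-order ODE, regarded as a curve in the affine coordinate plane $(C_1,C_2)$ of $S$ (where $u=u_p+C_1y_1+C_2y_2$); the map $s\mapsto(c_1(s),c_2(s))$ parametrizes $\Gamma$ as a curve in this plane. Solutions of the Riccati equation $w'+w^2+\kappa(x)=0$ are identified with points of the projective line $\mathbb{P}(V)\cong\mathbb{RP}^1$: the class $[y]$ of $y=C_1y_1+C_2y_2\in V\setminus\{0\}$, with homogeneous coordinates $[C_1:C_2]$, corresponds to $$w=\frac{y'}{y}=\frac{C_1y_1'+C_2y_2'}{C_1y_1+C_2y_2}.$$ Standing assumptions: $\phi$ is sufficiently smooth on an open set $D\subset\mathbb{R}^2$ with connected fibers $D_x=\{u\in\mathbb{R}:(x,u)\in D\}$; subscripts on $\phi$ denote partial derivatives; all assertions are local ($D$ and the intervals of definition of solutions may be shrunk so that every quantity appearing is defined and sufficiently smooth). *)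

(* Defs.v *)
From Stdlib Require Export Reals.
From Coquelicot Require Export Coquelicot.
Open Scope R_scope.

Definition d_x (phi : R -> R -> R) (x u : R) : R := Derive (fun t => phi t u) x.
Definition d_u (phi : R -> R -> R) (x u : R) : R := Derive (fun t => phi x t) u.

(* phi_{xu} is read as d_u (d_x phi); for C^2 functions the order is immaterial. *)
Definition curvature (phi : R -> R -> R) (x u : R) : R :=
  - (d_u (d_x phi) x u + d_u phi x u ^ 2 + phi x u * d_u (d_u phi) x u).

Definition forcing (phi : R -> R -> R) (kappa : R -> R) (x u : R) : R :=
  d_x phi x u + phi x u * d_u phi x u + kappa x * u.

(* [ex_diff_n] requires all partial derivatives of order <= n at the point to
   exist (with those of lower order) and to be continuous in both variables. *)
Definition Cn_on (n : nat) (D : R -> R -> Prop) (phi : R -> R -> R) : Prop :=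
  forall x u, D x u -> ex_diff_n phi n x u.

Definition C1_on (J : R -> Prop) (g : R -> R) : Prop :=
  forall s, J s -> ex_derive g s /\ continuous (Derive g) s.

(* The open interval with possibly infinite endpoints. *)
Definition oint (a b : Rbar) (x : R) : Prop := Rbar_lt a x /\ Rbar_lt x b.

Definition solves_ode (I : R -> Prop) (D : R -> R -> Prop)
    (phi : R -> R -> R) (u : R -> R) : Prop :=
  forall x, I x -> D x (u x) /\ is_derive u x (phi x (u x)).

(* [ex_derive u x] is needed separately, since [Derive] is total. *)
Definition solves_linear (I : R -> Prop) (kappa c u : R -> R) : Prop :=
  forall x, I x ->
    ex_derive u x /\ ex_derive (Derive u) x /\
    Derive (Derive u) x + kappa x * u x = c x.

Definition in_V (I : R -> Prop) (kappa y : R -> R) : Prop :=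
  solves_linear I kappa (fun _ => 0) y.

Definition basis_of_V (I : R -> Prop) (kappa y1 y2 : R -> R) : Prop :=
  in_V I kappa y1 /\ in_V I kappa y2 /\
  (forall C1 C2, (forall x, I x -> C1 * y1 x + C2 * y2 x = 0) ->
     C1 = 0 /\ C2 = 0) /\
  (forall y, in_V I kappa y ->
     exists C1 C2, forall x, I x -> y x = C1 * y1 x + C2 * y2 x).

Definition solves_riccati (I : R -> Prop) (kappa p : R -> R) : Prop :=
  forall x, I x -> ex_derive p x /\ Derive p x + p x ^ 2 + kappa x = 0.

(* The function w corresponds to the point [C1 : C2] of P(V) = RP^1.  Since w is
   defined on all of I, the representative y must not vanish on I. *)
Definition has_hom_coords (I : R -> Prop) (y1 y2 w : R -> R) (C1 C2 : R) : Prop :=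
  (C1, C2) <> (0, 0) /\
  forall x, I x ->
    C1 * y1 x + C2 * y2 x <> 0 /\
    w x = (C1 * Derive y1 x + C2 * Derive y2 x) / (C1 * y1 x + C2 * y2 x).

(* The solution set of u' = phi(x,u), in the affine coordinates (C1, C2) of
   u_p + V. *)
Definition Gamma (I : R -> Prop) (D : R -> R -> Prop) (phi : R -> R -> R)
    (up y1 y2 : R -> R) (C : R * R) : Prop :=
  solves_ode I D phi (fun x => up x + fst C * y1 x + snd C * y2 x).

(* [v1 : v2] is the direction of the nonzero velocity at P of a curve lying in
   the planar set A. *)
Definition tangent_direction (A : R * R -> Prop) (P : R * R) (v1 v2 : R) : Prop :=
  (v1, v2) <> (0, 0) /\
  exists g1 g2 : R -> R,
    locally 0 (fun t => A (g1 t, g2 t)) /\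
    (g1 0, g2 0) = P /\ is_derive g1 0 v1 /\ is_derive g2 0 v2.

(* Main.v *)
(** Differentiating [f' = phi(x,f)] with respect to the parameter along any curve in Gamma
    shows that the velocity [h = v1 y1 + v2 y2] solves the variational equation
    [h' = phi_u(x,f) h].  Hence [h] vanishes identically or nowhere; the former is
    excluded by the independence of [y1, y2], and then [phi_u(x,f) = h'/h].  The Riccati
    equation and the independence of [u] of the forcing term are the curvature hypothesis
    read along a solution and along a fiber, respectively. *)

From Stdlib Require Import Lra.
Require Import Defs.

(** * Open intervals and the scalar linear equation *)

Lemma oint_segment (a b : Rbar) (x y z : R) :
  oint a b x -> oint a b y -> Rmin x y <= z <= Rmax x y -> oint a b z.
Proof.
  intros [ax xb] [ay yb] [lo hi].
  split.
  - apply Rbar_lt_le_trans with (Rmin x y); [|exact lo].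
    now unfold Rmin; destruct (Rle_dec x y).
  - apply Rbar_le_lt_trans with (Rmax x y); [exact hi|].
    now unfold Rmax; destruct (Rle_dec x y).
Qed.

Lemma oint_locally (a b : Rbar) (x : R) (P : R -> Prop) :
  oint a b x -> (forall y, oint a b y -> P y) -> locally x P.
Proof.
  intros [ax xb] HP.
  apply (locally_interval P x a b ax xb).
  intros y ay yb; apply HP; now split.
Qed.

Lemma is_derive_0_const (f : R -> R) (x y : R) :
  (forall z, Rmin x y <= z <= Rmax x y -> is_derive f z 0) -> f x = f y.
Proof.
  intros df.
  destruct (MVT_gen f x y (fun _ => 0)) as [z [_ Hz]].
  - intros z Hz; apply df; lra.
  - intros z Hz; apply continuity_pt_filterlim.
    apply (ex_derive_continuous (V := R_NormedModule)); exists 0; now apply df.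
  - lra.
Qed.

(* Uses the integrating factor [exp (- \int_{x0}^x p)]. *)
Lemma linear_ode_zero (a b : Rbar) (p h : R -> R) (x0 : R) :
  (forall x, oint a b x -> continuous p x) ->
  (forall x, oint a b x -> is_derive h x (p x * h x)) ->
  oint a b x0 -> h x0 = 0 -> forall x, oint a b x -> h x = 0.
Proof.
  intros cp dh I0 h0 x Ix.
  set (P := RInt p x0).
  assert (dP : forall z, oint a b z -> is_derive P z (p z)).
  { intros z Iz.
    apply (is_derive_RInt p P x0 z).
    - apply oint_locally with (1 := Iz); intros w Iw.
      apply (RInt_correct (V := R_CompleteNormedModule)).
      apply (ex_RInt_continuous (V := R_CompleteNormedModule)).
      intros t Ht; apply cp; now apply oint_segment with x0 w.
    - now apply cp. }
  assert (E : h x0 * exp (- P x0) = h x * exp (- P x)).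
  { apply (is_derive_0_const (fun z => h z * exp (- P z))).
    intros z Hz.
    assert (Iz : oint a b z) by now apply oint_segment with x0 x.
    pose proof (dh z Iz) as dhz; pose proof (dP z Iz) as dPz.
    auto_derive.
    - split; [now exists (p z * h z)|]. split; [now exists (p z)|exact I].
    - rewrite (is_derive_unique _ _ _ dhz : Derive (fun t => h t) z = _).
      rewrite (is_derive_unique _ _ _ dPz : Derive (fun t => P t) z = _).
      ring. }
  rewrite h0, Rmult_0_l in E.
  pose proof (exp_pos (- P x)) as pos.
  symmetry in E; apply Rmult_integral in E.
  destruct E; [assumption|lra].
Qed.

(** * Curvature along solutions and along fibers *)

Lemma open_locally_2d (D : R -> R -> Prop) (x u : R) :
  open (fun q : R * R => D (fst q) (snd q)) -> D x u -> locally_2d D x u.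
Proof.
  intros oD Dxu; apply locally_2d_locally; exact (oD (x, u) Dxu).
Qed.

(** Needed because the chain rule along a solution produces [d_x (d_u phi)], whereas [curvature] is
    written with [d_u (d_x phi)]. *)
Lemma d_u_d_x_comm (D : R -> R -> Prop) (phi : R -> R -> R) (x u : R) :
  open (fun q : R * R => D (fst q) (snd q)) -> Cn_on 2 D phi -> D x u ->
  d_x (d_u phi) x u = d_u (d_x phi) x u.
Proof.
  intros oD Cphi Dxu.
  apply (Schwarz phi x u).
  - destruct (open_locally_2d D x u oD Dxu) as [d Hd].
    exists d; intros s t Hs Ht.
    (* [ex_diff_n] unfolds to continuity, the two first partials, then the same data one order lower
       for [d_x phi] and for [d_u phi]. *)
    destruct (Cphi s t (Hd s t Hs Ht)) as (_ & e1 & e2 & (_ & _ & e3 & _) & (_ & e4 & _)).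
    now repeat split.
  - now destruct (Cphi x u Dxu) as (_ & _ & _ & _ & (_ & _ & _ & (c & _) & _)).
  - now destruct (Cphi x u Dxu) as (_ & _ & _ & (_ & _ & _ & _ & (c & _)) & _).
Qed.

Lemma is_derive_d_u_along_solution (D : R -> R -> Prop) (phi : R -> R -> R)
    (u : R -> R) (x : R) :
  open (fun q : R * R => D (fst q) (snd q)) -> Cn_on 2 D phi ->
  D x (u x) -> is_derive u x (phi x (u x)) ->
  is_derive (fun t => d_u phi t (u t)) x
    (d_u (d_x phi) x (u x) + d_u (d_u phi) x (u x) * phi x (u x)).
Proof.
  intros oD Cphi Dx du.
  rewrite <- (d_u_d_x_comm D phi x (u x) oD Cphi Dx).
  (* The factor 1 is the derivative of the first component of [t => (t, u t)]. *)
  replace (d_x (d_u phi) x (u x)) with (d_x (d_u phi) x (u x) * 1) by ring.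
  apply is_derive_Reals.
  apply (derivable_pt_lim_comp_2d (d_u phi) (fun t => t) u).
  - apply filterdiff_differentiable_pt_lim.
    (* Total differentiability of [d_u phi]: the x-partial exists nearby and is continuous at the
       point, and the u-partial exists there. *)
    apply (is_derive_filterdiff (d_u phi) x (u x) (d_x (d_u phi))).
    + generalize (oD (x, u x) Dx); apply filter_imp; intros [s t] Dst.
      destruct (Cphi s t Dst) as (_ & _ & _ & _ & (_ & e & _)).
      exact (Derive_correct _ _ e).
    + destruct (Cphi x (u x) Dx) as (_ & _ & _ & _ & (_ & _ & e & _)).
      exact (Derive_correct _ _ e).
    + destruct (Cphi x (u x) Dx) as (_ & _ & _ & _ & (_ & _ & _ & (c & _) & _)).
      apply continuity_2d_pt_filterlim in c; exact c.
  - apply derivable_pt_lim_id.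
  - now apply is_derive_Reals.
Qed.

(** With $p=\phi_u(x,u(x))$ and $u'=\phi$, the chain rule gives
    $p'=\phi_{xu}+\phi\,\phi_{uu}=-\mathcal{K}-p^2$. *)
Lemma riccati_along_solution (I : R -> Prop) (D : R -> R -> Prop)
    (phi : R -> R -> R) (kappa u : R -> R) :
  open (fun q : R * R => D (fst q) (snd q)) -> Cn_on 2 D phi ->
  (forall x v, D x v -> curvature phi x v = kappa x) ->
  solves_ode I D phi u ->
  solves_riccati I kappa (fun x => d_u phi x (u x)).
Proof.
  intros oD Cphi curv sol x Ix.
  destruct (sol x Ix) as [Dx du].
  pose proof (is_derive_d_u_along_solution D phi u x oD Cphi Dx du) as dp.
  split; [eexists; exact dp|].
  rewrite (is_derive_unique _ _ _ dp : Derive (fun t => d_u phi t (u t)) x = _), <- (curv x (u x) Dx).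
  unfold curvature; ring.
Qed.

(** The u-derivative of $\phi_x+\phi\,\phi_u$ is
    $\phi_{xu}+\phi_u^2+\phi\,\phi_{uu}=-\mathcal{K}$. *)
Lemma is_derive_forcing (D : R -> R -> Prop) (phi : R -> R -> R)
    (kappa : R -> R) (x u : R) :
  Cn_on 2 D phi -> D x u ->
  is_derive (forcing phi kappa x) u (kappa x - curvature phi x u).
Proof.
  intros Cphi Dxu.
  destruct (Cphi x u Dxu) as (_ & _ & e1 & (_ & _ & e2 & _) & (_ & _ & e3 & _)).
  unfold forcing, curvature.
  auto_derive.
  - now repeat split.
  - unfold d_u, d_x; ring.
Qed.

Lemma forcing_const_on_fibers (D : R -> R -> Prop) (phi : R -> R -> R)
    (kappa : R -> R) (x u v : R) :
  is_connected (D x) -> Cn_on 2 D phi ->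
  (forall x u, D x u -> curvature phi x u = kappa x) ->
  D x u -> D x v -> forcing phi kappa x u = forcing phi kappa x v.
Proof.
  intros conn Cphi curv Du Dv.
  apply is_derive_0_const; intros z Hz.
  (* Connectedness of the fiber is order convexity, so the segment between [u] and [v] stays in it,
     whichever endpoint is larger. *)
  assert (Dz : D x z).
  { revert Hz; unfold Rmin, Rmax; destruct (Rle_dec u v); intros Hz.
    - now apply (conn u v).
    - now apply (conn v u). }
  replace 0 with (kappa x - curvature phi x z) by (rewrite curv by exact Dz; ring).
  now apply is_derive_forcing with D.
Qed.

(** * Variation along curves in [Gamma] *)

Lemma is_derive_affine_comb (c0 c1 c2 : R) (g1 g2 : R -> R) (t v1 v2 : R) :
  is_derive g1 t v1 -> is_derive g2 t v2 ->
  is_derive (fun s => c0 + g1 s * c1 + g2 s * c2) t (v1 * c1 + v2 * c2).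
Proof.
  intros d1 d2.
  auto_derive.
  - split; [now exists v1|]. split; [now exists v2|exact I].
  - rewrite (is_derive_unique _ _ _ d1 : Derive (fun s => g1 s) t = _).
    rewrite (is_derive_unique _ _ _ d2 : Derive (fun s => g2 s) t = _); ring.
Qed.

(** At fixed [x], both sides of the ODE are differentiated in [t] at 0. The x-derivative of the
    solution is again affine in [g1 t], [g2 t], with coefficients [Derive y1 x], [Derive y2 x], so
    no interchange of derivatives in [x] and [t] arises. *)
Lemma variational_equation (I : R -> Prop) (D : R -> R -> Prop)
    (phi : R -> R -> R) (up y1 y2 g1 g2 : R -> R) (v1 v2 x : R) :
  Cn_on 2 D phi -> I x ->
  ex_derive up x -> ex_derive y1 x -> ex_derive y2 x ->
  locally 0 (fun t => Gamma I D phi up y1 y2 (g1 t, g2 t)) ->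
  is_derive g1 0 v1 -> is_derive g2 0 v2 ->
  v1 * Derive y1 x + v2 * Derive y2 x =
  d_u phi x (up x + g1 0 * y1 x + g2 0 * y2 x) * (v1 * y1 x + v2 * y2 x).
Proof.
  intros Cphi Ix eup e1 e2 HG d1 d2.
  assert (D0 : D x (up x + g1 0 * y1 x + g2 0 * y2 x)).
  { exact (proj1 (locally_singleton _ _ HG x Ix)). }
  destruct (Cphi _ _ D0) as (_ & _ & eu & _).
  apply Derive_correct in eu.
  assert (dL := is_derive_affine_comb (Derive up x) (Derive y1 x) (Derive y2 x) _ _ _ _ _ d1 d2).
  assert (dR := is_derive_comp (phi x) _ 0 _ _ eu
                 (is_derive_affine_comb (up x) (y1 x) (y2 x) _ _ _ _ _ d1 d2)).
  apply is_derive_unique in dR; apply is_derive_unique in dL.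
  rewrite <- dL.
  transitivity (Derive (fun t => phi x (up x + g1 t * y1 x + g2 t * y2 x)) 0).
  2: { etransitivity; [exact dR|]. apply Rmult_comm. }
  (* The curve lies in [Gamma] only for [t] near 0, so the two sides agree only locally. *)
  apply Derive_ext_loc.
  generalize HG; apply filter_imp; intros t Ht.
  destruct (Ht x Ix) as [_ dt]; simpl in dt.
  apply is_derive_unique in dt; rewrite <- dt.
  symmetry; apply is_derive_unique.
  auto_derive.
  - now repeat split.
  - rewrite !Rmult_1_l; reflexivity.
Qed.

Lemma tangent_direction_hom_coords (a b : Rbar) (D : R -> R -> Prop)
    (phi : R -> R -> R) (kappa c up y1 y2 : R -> R) (P : R * R) (v1 v2 : R) :
  open (fun q : R * R => D (fst q) (snd q)) -> Cn_on 2 D phi ->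
  solves_linear (oint a b) kappa c up ->
  basis_of_V (oint a b) kappa y1 y2 ->
  tangent_direction (Gamma (oint a b) D phi up y1 y2) P v1 v2 ->
  has_hom_coords (oint a b) y1 y2
    (fun x => d_u phi x (up x + fst P * y1 x + snd P * y2 x)) v1 v2.
Proof.
  intros oD Cphi Hup (V1 & V2 & indep & _) [v0 (g1 & g2 & HG & <- & d1 & d2)].
  set (p := fun x => d_u phi x _).
  set (h := fun x => v1 * y1 x + v2 * y2 x).
  assert (var : forall x, oint a b x ->
            v1 * Derive y1 x + v2 * Derive y2 x = p x * h x).
  { intros x Ix.
    apply variational_equation with (1 := Cphi) (2 := Ix); try assumption.
    - apply (Hup x Ix).
    - apply (V1 x Ix).
    - apply (V2 x Ix). }
  assert (dh : forall x, oint a b x -> is_derive h x (p x * h x)).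
  { intros x Ix; rewrite <- (var x Ix).
    destruct (V1 x Ix) as [e1 _], (V2 x Ix) as [e2 _].
    unfold h; auto_derive; [now repeat split|rewrite !Rmult_1_l; reflexivity]. }
  (* Makes the integrating factor available: [p] is differentiable, being [d_u phi] along a
     solution. *)
  assert (cp : forall x, oint a b x -> continuous p x).
  { intros x Ix.
    destruct (locally_singleton _ _ HG x Ix) as [D0 d0].
    apply (ex_derive_continuous (V := R_NormedModule)).
    eexists; exact (is_derive_d_u_along_solution D phi _ x oD Cphi D0 d0). }
  split; [exact v0|].
  intros x Ix.
  (* A single zero would make [h] vanish on the whole interval, and independence would give
     [v1 = v2 = 0]. *)
  assert (hx : h x <> 0).
  { intros h0; apply v0.
    destruct (indep v1 v2) as [-> ->]; [|reflexivity].
    exact (linear_ode_zero a b p h x cp dh Ix h0). }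
  split; [exact hx|].
  rewrite (var x Ix); fold (h x); field; exact hx.
Qed.

(** [tangent_direction] bases its curves at time 0, so the parameter is translated by [s]. *)
Lemma curve_tangent_direction (A : R * R -> Prop) (c1 c2 : R -> R) (s : R) :
  locally s (fun t => A (c1 t, c2 t)) -> ex_derive c1 s -> ex_derive c2 s ->
  (Derive c1 s, Derive c2 s) <> (0, 0) ->
  tangent_direction A (c1 s, c2 s) (Derive c1 s) (Derive c2 s).
Proof.
  intros HA e1 e2 nz.
  split; [exact nz|].
  exists (fun t => c1 (s + t)), (fun t => c2 (s + t)).
  split; [|split; [|split]].
  - destruct HA as [d Hd]; exists d; intros t Ht; apply Hd.
    revert Ht; unfold ball; simpl; unfold AbsRing_ball, abs, minus, plus, opp; simpl.
    now replace (s + t + - s) with (t + - 0) by ring.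
  - now rewrite Rplus_0_r.
  - auto_derive; [now rewrite Rplus_0_r|rewrite Rplus_0_r; apply Rmult_1_l].
  - auto_derive; [now rewrite Rplus_0_r|rewrite Rplus_0_r; apply Rmult_1_l].
Qed.

(** * The family and its tangent direction *)

Lemma has_hom_coords_ext (I : R -> Prop) (y1 y2 w w' : R -> R) (C1 C2 : R) :
  (forall x, I x -> w x = w' x) ->
  has_hom_coords I y1 y2 w C1 C2 -> has_hom_coords I y1 y2 w' C1 C2.
Proof.
  intros E [nz H]; split; [exact nz|].
  intros x Ix; rewrite <- (E x Ix); exact (H x Ix).
Qed.

(** The velocity is assumed nonzero where coordinates are asserted, since [0 : 0] is not a point of
    P(V). The last clause covers every curve in [Gamma] through the point; as [p] determines its
    class in P(V), the tangent direction there is unique. *)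
Theorem proposition6p1
    (D : R -> R -> Prop) (phi : R -> R -> R) (kappa : R -> R)
    (D_open : open (fun q : R * R => D (fst q) (snd q)))
    (D_fibers : forall x, is_connected (D x))
    (phi_smooth : Cn_on 2 D phi)
    (curv : forall x u, D x u -> curvature phi x u = kappa x) :
  (forall x u v, D x u -> D x v -> forcing phi kappa x u = forcing phi kappa x v) /\
  forall (a b : Rbar) (sa sb : Rbar) (y1 y2 c up : R -> R)
    (f : R -> R -> R) (c1 c2 : R -> R),
    let I := oint a b in
    let J := oint sa sb in
    Rbar_lt a b ->
    Rbar_lt sa sb ->
    basis_of_V I kappa y1 y2 ->
    (forall x u, D x u -> c x = forcing phi kappa x u) ->
    solves_linear I kappa c up ->
    (forall s, J s -> solves_ode I D phi (fun x => f x s)) ->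
    C1_on J c1 ->
    C1_on J c2 ->
    (forall x s, I x -> J s -> f x s = up x + c1 s * y1 x + c2 s * y2 x) ->
    forall s, J s ->
      let p := fun x => d_u phi x (f x s) in
      solves_riccati I kappa p /\
      ((Derive c1 s, Derive c2 s) <> (0, 0) ->
         has_hom_coords I y1 y2 p (Derive c1 s) (Derive c2 s) /\
         tangent_direction (Gamma I D phi up y1 y2) (c1 s, c2 s)
           (Derive c1 s) (Derive c2 s) /\
         forall v1 v2,
           tangent_direction (Gamma I D phi up y1 y2) (c1 s, c2 s) v1 v2 ->
           has_hom_coords I y1 y2 p v1 v2).
Proof.
  split.
  { intros x u v; now apply forcing_const_on_fibers with (D := D). }
  intros a b sa sb y1 y2 c up f c1 c2 I J _ _ basis _ Hup sol C1 C2 Hf s Js p.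
  split; [now apply riccati_along_solution with (D := D), sol|].
  intros nz.
  assert (onG : forall t, J t -> Gamma I D phi up y1 y2 (c1 t, c2 t)).
  { intros t Jt x Ix; simpl.
    rewrite <- (Hf x t Ix Jt).
    destruct (sol t Jt x Ix) as [Dx dx].
    split; [exact Dx|].
    (* The affine form of [f] is known only on [I]; openness of [I] lets the derivative carry
       over. *)
    apply is_derive_ext_loc with (2 := dx).
    apply oint_locally with (1 := Ix); intros y Iy; now apply Hf. }
  (* Proved for an arbitrary tangent vector; the velocity of the family is then a special case. *)
  assert (coords : forall v1 v2,
            tangent_direction (Gamma I D phi up y1 y2) (c1 s, c2 s) v1 v2 ->
            has_hom_coords I y1 y2 p v1 v2).
  { intros v1 v2 Hv.
    apply has_hom_coords_ext with
      (fun x => d_u phi x (up x + c1 s * y1 x + c2 s * y2 x)).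
    - intros x Ix; unfold p; now rewrite (Hf x s Ix Js).
    - now apply tangent_direction_hom_coords with
        (kappa := kappa) (c := c) (D := D) (P := (c1 s, c2 s)). }
  assert (T : tangent_direction (Gamma I D phi up y1 y2) (c1 s, c2 s)
                (Derive c1 s) (Derive c2 s)).
  { apply curve_tangent_direction; [|apply (C1 s Js)|apply (C2 s Js)|exact nz].
    apply oint_locally with (1 := Js); exact onG. }
  split; [now apply coords|].
  now split.
Qed.
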